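(* Let $s\ge 1$ and $t\ge 1$ be integers. Then $\chi_p(P_{2t}\Diamond_2 C_{4s+3})\le 4$ if $1\le t\le 2$, and $\chi_p(P_{2t}\Diamond_2 C_{4s+3})\le 5$ if $t\ge 3$. Moreover, equality holds for $t\in\{1,2\}$.
   Context: A packing $k$-coloring of a graph $H$ is a map $c:V(H)\to\{1,\ldots,k\}$ such that any two distinct vertices $u,v$ with $c(u)=c(v)=i$ satisfy $d_H(u,v)\ge i+1$. The packing chromatic number $\chi_p(H)$ is the least such $k$. $P_m$ denotes the path $v_1\cdots v_m$ and $C_n$ the cycle on $n$ vertices. Path-aligned product: for positive integers $\ell\mid m$ and a connected vertex-transitive graph $G$ containing $P_\ell$ as a subgraph, $P_m\Diamond_\ell G$ is formed from the path $P_m=v_1\cdots v_m$ and $m/\ell$ pairwise disjoint copies of $G$, where for each $1\le i\le m/\ell$ the consecutive path vertices $v_{(i-1)\ell+1},\ldots,v_{i\ell}$ are identified, in order, with the vertices of a path $P_\ell$ (i.e. $\ell$ consecutive cycle vertices when $G$ is a cycle) in the $i$-th copy of $G$. *)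

(* Defs.v *)
From mathcomp Require Export all_boot.

Set Implicit Arguments.
Unset Strict Implicit.
Unset Printing Implicit Defensive.

Section Distance.

Variables (T : finType) (e : rel T).

Definition walk (u v : T) (n : nat) : bool :=
  [exists w : n.-tuple T, path e u w && (last u w == v)].

Lemma connect_walk u v : connect e u v -> exists n, walk u v n.
Proof.
case/connectP=> w e_w ->; exists (size w); apply/existsP.
by exists (in_tuple w); rewrite e_w eqxx.
Qed.

(* None stands for infinite distance *)
Definition gdist (u v : T) : option nat :=
  match @idP (connect e u v) with
  | ReflectT uv => Some (ex_minn (connect_walk uv))
  | ReflectF _ => None
  end.

Lemma gdist_le u v n :
  (exists2 d, gdist u v = Some d & d <= n) <->
  (exists w, [/\ path e u w, last u w = v & size w <= n]).
Proof.
rewrite /gdist; split.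
  case: {-}_ / idP => [uv|_] [_ // [<-]].
  case: ex_minnP => d /existsP[w /andP[e_w /eqP w_v]] _ le_dn.
  by exists w; rewrite size_tuple.
case=> w [e_w w_v le_wn].
case: {-}_ / idP => [uv|[]]; last by apply/connectP; exists w.
exists (ex_minn (connect_walk uv)) => //; case: ex_minnP => d _ min_d.
apply: leq_trans le_wn; apply/min_d/existsP.
by exists (in_tuple w); rewrite e_w w_v eqxx.
Qed.

Definition gdist_ge (u v : T) (n : nat) : bool :=
  if gdist u v is Some d then n <= d else true.

End Distance.

Section PackingColoring.

Variables (T : finType) (e : rel T).

(* The element j of 'I_k encodes the color j + 1 of {1, ..., k}. *)
Definition color k (c : {ffun T -> 'I_k}) (u : T) : nat := (c u).+1.

Definition packing_coloring k (c : {ffun T -> 'I_k}) : bool :=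
  [forall u, forall v, (u != v) && (color c u == color c v) ==>
    gdist_ge e u v (color c u).+1].

Definition packing_colorable (k : nat) : bool :=
  [exists c : {ffun T -> 'I_k}, packing_coloring c].

Lemma packing_colorable_ex : exists k, packing_colorable k.
Proof.
exists #|T|; apply/existsP; exists [ffun u => enum_rank u].
apply/forallP=> u; apply/forallP=> v; apply/implyP=> /andP[/eqP uv].
by rewrite /color !ffunE eqSS => /eqP/val_inj/enum_rank_inj.
Qed.

Definition packing_chromatic_number : nat := ex_minn packing_colorable_ex.

End PackingColoring.

(* A simple graph on n vertices only for n >= 3. *)
Definition cycle_graph (n : nat) : rel 'I_n :=
  [rel i j | (ordS i == j) || (ordS j == i)].

Definition path_in (T : finType) (e : rel T) (p : seq T) : bool :=
  uniq p && sorted e p.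

Section PathAlignedProduct.

(* The vertices x_1 ... x_l of p i are those of the i-th copy of (V, e) that
   are identified, in this order, with the i-th block of l consecutive vertices
   of the path P_m. When l divides m, every vertex of P_m is identified with a
   vertex of some copy, so the vertices of the product are those of the m / l
   disjoint copies. *)
Variables (m l : nat) (V : finType) (e : rel V).
Variable p : 'I_(m %/ l) -> l.-tuple V.

(* The vertex v_(j+1) of P_m is identified with x. *)
Definition path_vertex (j : nat) (x : 'I_(m %/ l) * V) : bool :=
  (x.1 == j %/ l :> nat) && (onth (p x.1) (j %% l) == Some x.2).

Definition path_aligned_product : rel ('I_(m %/ l) * V) :=
  [rel x y | (x.1 == y.1) && e x.2 y.2 ||
    [exists j : 'I_m.-1, path_vertex j x && path_vertex j.+1 y ||
                         path_vertex j y && path_vertex j.+1 x]].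

End PathAlignedProduct.

Lemma cycle_graph_sym n : symmetric (@cycle_graph n).
Proof. by move=> i j; rewrite /cycle_graph /= orbC. Qed.

Lemma cycle_graph_irr n : 1 < n -> irreflexive (@cycle_graph n).
Proof.
move=> n_gt1 i; rewrite /cycle_graph /= orbb -val_eqE /=; apply/eqP.
have := ltn_ord i; rewrite leq_eqVlt => /orP[/eqP i_n|lt_i].
  by rewrite i_n modnn => i0; rewrite -i_n -i0 in n_gt1.
by rewrite modn_small // => /eqP; rewrite eqn_leq ltnn.
Qed.

Lemma path_aligned_product_sym m l (V : finType) (e : rel V)
    (p : 'I_(m %/ l) -> l.-tuple V) :
  symmetric e -> symmetric (path_aligned_product e p).
Proof.
move=> e_sym x y; rewrite /path_aligned_product /= eq_sym e_sym; congr (_ || _).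
by apply: eq_existsb => j; rewrite orbC.
Qed.

Lemma path_aligned_product_irr m l (V : finType) (e : rel V)
    (p : 'I_(m %/ l) -> l.-tuple V) :
    irreflexive e -> (forall i, path_in e (p i)) ->
  irreflexive (path_aligned_product e p).
Proof.
move=> e_irr p_path x; rewrite /path_aligned_product /= eqxx e_irr /=; apply/existsP=> -[j].
rewrite orbb => /andP[/andP[/eqP xj /eqP pj] /andP[/eqP xj1 /eqP pj1]].
have /andP[p_uniq _] := p_path x.1.
have lt_j: j %% l < size (p x.1) by rewrite -onthTE pj.
have lt_j1: j.+1 %% l < size (p x.1) by rewrite -onthTE pj1.
have := nth_uniq x.2 lt_j lt_j1 p_uniq.
have -> := @onth_nth _ x.2 _ _ _ pj; have -> := @onth_nth _ x.2 _ _ _ pj1.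
rewrite eqxx => /esym/eqP eq_mod.
have := divn_eq j l; rewrite -xj eq_mod {1}xj1 -divn_eq => /eqP.
by rewrite eqn_leq ltnn andbF.
Qed.

(* Main.v *)
(** Upper bounds: number each copy of the cycle so that the path enters it at
    position 0 and leaves it at position 1, and color the copies alternately by
    the words (1312)^s 1 4 z and (1213)^s 1 2 4, where z = 2 suffices for t <= 2
    and z = 5 works for every t. Distances are bounded from below by an explicit
    function that varies by at most 1 along each edge.
    Lower bound: in a packing 3-coloring of a cycle with more than 3 vertices,
    the color 1 must alternate, which is impossible on an odd cycle. *)

Require Import Defs.
From mathcomp Require Import zify.

Section GraphDistance.

Variables (T : finType) (e : rel T).

Lemma gdist_ge_path u v n w :
  gdist_ge e u v n -> path e u w -> last u w = v -> n <= size w.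
Proof.
move=> uv_n e_w w_v.
have [|d def_d le_dw] := (gdist_le e u v (size w)).2; first by exists w.
by move: uv_n; rewrite /gdist_ge def_d => /leq_trans; apply.
Qed.

Lemma gdist_ge_lipschitz (D : T -> nat) u v :
    D v = 0 -> (forall x y, e x y -> D x <= (D y).+1) ->
  gdist_ge e u v (D u).
Proof.
move=> Dv D_lip; rewrite /gdist_ge; case def_d: gdist => [d|//].
have [|w [e_w w_v]] := (gdist_le e u v d).1; first by exists d.
apply: leq_trans; elim: w u e_w w_v {def_d} => [u _ /= ->|x w IHw u /=].
  by rewrite Dv.
case/andP=> e_ux e_w w_v; apply: leq_trans (D_lip _ _ e_ux) _.
by rewrite ltnS IHw.
Qed.

Lemma packing_chromatic_number_le k :
  packing_colorable e k -> packing_chromatic_number e <= k.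
Proof. by rewrite /packing_chromatic_number; case: ex_minnP => m _; apply. Qed.

End GraphDistance.

Lemma val_ordS n (x : 'I_n) : ordS x = (if x.+1 == n then 0 else x.+1) :> nat.
Proof.
rewrite /=; case: eqP => [->|/eqP x_n]; first by rewrite modnn.
by rewrite modn_small // ltn_neqAle x_n ltn_ord.
Qed.

Section OddCycle.

Variables (n : nat) (T : finType) (e : rel T) (h : 'I_n -> T).
Hypothesis h_inj : injective h.
Hypothesis h_hom : forall x y, cycle_graph x y -> e (h x) (h y).

(* In a packing 3-coloring, two consecutive vertices colored 2 or 3 cannot be
   extended to both sides, so the color 1 alternates around the cycle. *)
Lemma odd_cycle_packing_ge4 k :
  3 < n -> odd n -> packing_colorable e k -> 3 < k.
Proof.
move=> n_gt3 n_odd /existsP[c /forallP c_pack]; rewrite ltnNge; apply/negP=> k_le3.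
have n_gt0 : 0 < n by apply: leq_trans n_gt3.
pose o m : 'I_n := Ordinal (ltn_pmod m n_gt0).
have oS m : ordS (o m) = o m.+1.
  by apply: val_inj; rewrite /= -addn1 modnDml addn1.
pose f m := color c (h (o m)).
have f_bounds m : 0 < f m <= 3.
  by rewrite /f /color /= (leq_trans (ltn_ord _) k_le3).
have f_sep m d : 0 < d -> d < n -> f m = f (m + d) -> f m < d.
  move=> d_gt0 d_lt_n eq_f.
  have o_neq : h (o m) != h (o (m + d)).
    rewrite (inj_eq h_inj) -val_eqE /= -{1}[m]addn0 eqn_modDl mod0n modn_small //.
    by rewrite eq_sym -lt0n.
  have := forallP (c_pack (h (o m))) (h (o (m + d))).
  rewrite o_neq -/(f m) -/(f (m + d)) eq_f eqxx /= -eq_f => /gdist_ge_path m_sep.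
  have := m_sep [seq h (o i) | i <- iota m.+1 d].
  rewrite size_map size_iota; apply.
    elim: (d) (m) => [//|d' IHd m'] /=; rewrite IHd andbT h_hom //.
    by rewrite /cycle_graph /= oS eqxx.
  rewrite last_map; congr (h (o _)).
  by rewrite (last_nth 0) size_iota; apply: (nth_iota 0 m (ltnSn d)).
have f1 m : f m <> f m.+1.
  by have := f_sep m 1; rewrite addn1 => f1 /f1; have := f_bounds m; lia.
have f2 m : f m = f m.+2 -> f m = 1.
  by have := f_sep m 2; rewrite addn2 => f2 /f2; have := f_bounds m; lia.
have f3 m : f m = f m.+3 -> f m <= 2.
  by have := f_sep m 3; rewrite addn3 => f3 /f3; have := f_bounds m; lia.
have f_alt m : (f m.+3 == 1) = ~~ (f m.+2 == 1).
  have [f3_1|f3_n1] := eqVneq (f m.+3) 1; have [f2_1|f2_n1] := eqVneq (f m.+2) 1 => //.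
    by case: (f1 m.+2); rewrite f2_1.
  have [[b2 b3] d23] := (f_bounds m.+2, f_bounds m.+3, f1 m.+2).
  have f1_1 : f m.+1 = 1 by have := (f_bounds m.+1, f1 m.+1, f2 m.+1) => -[[? ?] ?]; lia.
  have f4_1 : f m.+4 = 1 by have := (f_bounds m.+4, f1 m.+3, f2 m.+2) => -[[? ?] ?]; lia.
  have [f2_2|f2_n2] := eqVneq (f m.+2) 2.
    by have := (f_bounds m, f1 m, f2 m, f3 m) => -[[[? ?] ?] ?]; lia.
  by have := (f_bounds m.+4.+1, f1 m.+4, f2 m.+3, f3 m.+2) => -[[[? ?] ?] ?]; lia.
have f_odd m : (f m.+2 == 1) = odd m (+) (f 2 == 1).
  by elim: m => [//|m IHm]; rewrite f_alt IHm /= addNb.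
have /esym := f_odd n; rewrite n_odd /f.
have -> : o n.+2 = o 2 by apply: val_inj; rewrite /= -addn2 modnDl.
by case: (_ == _).
Qed.

End OddCycle.

Section CycleChain.

Variable s : nat.
Let n := 4 * s + 3.

Definition cycle_dist x y :=
  minn (maxn x y - minn x y) (4 * s + 3 - (maxn x y - minn x y)).

(* The vertex [x] of copy [i] has position [x] along the cycle; the path enters
   each copy at position 0 and leaves it at position 1. *)
Definition chain_dist (i x j y : nat) :=
  if i == j then cycle_dist x y else
  if i < j then cycle_dist x 1 + (2 * (j - i)).-1 + cycle_dist 0 y
  else cycle_dist x 0 + (2 * (i - j)).-1 + cycle_dist 1 y.

Inductive cycle_adj (x y : nat) : Prop :=
  | CycleAdjNext of y = x.+1
  | CycleAdjPrev of x = y.+1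
  | CycleAdjFirst of x = 0 & y = (4 * s).+2
  | CycleAdjLast of y = 0 & x = (4 * s).+2.

Inductive chain_adj (i x j y : nat) : Prop :=
  | ChainAdjIn of i = j & cycle_adj x y
  | ChainAdjNext of j = i.+1 & x = 1 & y = 0
  | ChainAdjPrev of i = j.+1 & y = 1 & x = 0.

Lemma chain_adj_sym i x j y : chain_adj i x j y -> chain_adj j y i x.
Proof.
case=> [-> adj|? ? ?|? ? ?]; [|exact: ChainAdjPrev|exact: ChainAdjNext].
apply: ChainAdjIn => //; case: adj => *.
- exact: CycleAdjPrev.
- exact: CycleAdjNext.
- exact: CycleAdjLast.
- exact: CycleAdjFirst.
Qed.

Lemma cycle_dist_lipschitz x y z :
    x < n -> y < n -> z < n -> cycle_adj x y ->
  cycle_dist x z <= (cycle_dist y z).+1.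
Proof. by rewrite /n /cycle_dist => x_n y_n z_n [] *; lia. Qed.

Lemma chain_dist_lipschitz i x j y k z :
    x < n -> y < n -> z < n -> chain_adj i x j y ->
  chain_dist i x k z <= (chain_dist j y k z).+1.
Proof.
move=> x_n y_n z_n; rewrite /chain_dist.
have n_gt1 : 1 < n by rewrite /n; lia.
have [cd00 cd11] : cycle_dist 0 0 = 0 /\ cycle_dist 1 1 = 0.
  by rewrite /cycle_dist; lia.
have [cd01 cd10] : cycle_dist 0 1 = 1 /\ cycle_dist 1 0 = 1.
  by move: n_gt1; rewrite /n /cycle_dist; lia.
case=> [-> adj|->->->|->->->].
- have lip w : w < n -> cycle_dist x w <= (cycle_dist y w).+1.
    by move=> w_n; apply: cycle_dist_lipschitz.
  have [[lip0 lip1] lipz] := (lip 0 (ltnW n_gt1), lip 1 n_gt1, lip z z_n).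
  by case: ltngtP => _; lia.
- by rewrite cd11 cd01 cd00 cd10; case: (ltngtP i k) => ?; case: (ltngtP i.+1 k) => ?; lia.
- by rewrite cd11 cd01 cd00 cd10; case: (ltngtP j k) => ?; case: (ltngtP j.+1 k) => ?; lia.
Qed.

(* The copies are numbered from 0: the even ones get (1312)^s 1 4 z and the odd
   ones (1213)^s 1 2 4. *)
Definition chain_color (z i x : nat) : nat :=
  if x == (4 * s).+2 then if odd i then 4 else z else
  if x == (4 * s).+1 then if odd i then 2 else 4 else
  if ~~ odd x then 1 else if (x %% 4 == 1) == odd i then 2 else 3.

Variant chain_color_spec (z i x : nat) : nat -> Prop :=
  | EvenOne q of x = 2 * q & q <= 2 * s & ~~ odd i : chain_color_spec z i x 1
  | EvenThree q of x = 4 * q + 1 & q < s & ~~ odd i : chain_color_spec z i x 3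
  | EvenTwo q of x = 4 * q + 3 & q < s & ~~ odd i : chain_color_spec z i x 2
  | EvenFour of x = 4 * s + 1 & ~~ odd i : chain_color_spec z i x 4
  | EvenLast of x = 4 * s + 2 & ~~ odd i : chain_color_spec z i x z
  | OddOne q of x = 2 * q & q <= 2 * s & odd i : chain_color_spec z i x 1
  | OddTwo q of x = 4 * q + 1 & q <= s & odd i : chain_color_spec z i x 2
  | OddThree q of x = 4 * q + 3 & q < s & odd i : chain_color_spec z i x 3
  | OddFour of x = 4 * s + 2 & odd i : chain_color_spec z i x 4.

Lemma chain_colorP z i x : x < n -> chain_color_spec z i x (chain_color z i x).
Proof.
rewrite /n /chain_color => x_n.
have [x_last|x_nlast] := eqVneq x (4 * s).+2.
  by case: (boolP (odd i)) => ?; [apply: OddFour | apply: EvenLast]; lia.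
have [x_last|x_nlast'] := eqVneq x (4 * s).+1.
  by case: (boolP (odd i)) => ?; [apply: (@OddTwo _ _ _ s) | apply: EvenFour]; lia.
case: ifP => x_odd.
  case: (boolP (odd i)) => ?; first by apply: (@OddOne _ _ _ x./2); lia.
  by apply: (@EvenOne _ _ _ x./2); lia.
case: (x %% 4 =P 1) => x_mod; case: (boolP (odd i)) => odd_i /=.
- by apply: (@OddTwo _ _ _ (x %/ 4)); lia.
- by apply: (@EvenThree _ _ _ (x %/ 4)); lia.
- by apply: (@OddThree _ _ _ (x %/ 4)); lia.
- by apply: (@EvenTwo _ _ _ (x %/ 4)); lia.
Qed.

Lemma cycle_distC x y : cycle_dist x y = cycle_dist y x.
Proof. by rewrite /cycle_dist (maxnC x) (minnC x). Qed.

Lemma chain_distC i x j y : chain_dist i x j y = chain_dist j y i x.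
Proof.
rewrite /chain_dist [cycle_dist y x]cycle_distC [cycle_dist y 0]cycle_distC.
rewrite [cycle_dist y 1]cycle_distC [cycle_dist 1 x]cycle_distC [cycle_dist 0 x]cycle_distC.
by case: ltngtP => // _; rewrite -addnA [RHS]addnC; congr (_ + _); rewrite addnC.
Qed.

Lemma chain_color_sep_in z i x y :
    0 < s -> z = 5 \/ z = 2 -> x < n -> y < n ->
    x <> y -> chain_color z i x = chain_color z i y ->
  chain_color z i x < cycle_dist x y.
Proof.
move=> s_gt0 z_val x_n y_n.
have [?|?|?|?|?|?|?|?|?] := chain_colorP z i x x_n;
  have [?|?|?|?|?|?|?|?|?] := chain_colorP z i y y_n.
all: rewrite /cycle_dist; case: z_val => z_val; rewrite ?z_val => *; try discriminate.
all: lia.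
Qed.

Lemma chain_color_sep_out z i x j y :
    0 < s -> z = 5 \/ z = 2 /\ j < 2 -> x < n -> y < n ->
    i < j -> chain_color z i x = chain_color z j y ->
  chain_color z i x < cycle_dist x 1 + (2 * (j - i)).-1 + cycle_dist 0 y.
Proof.
move=> s_gt0 z_val x_n y_n.
have [?|?|?|?|?|?|?|?|?] := chain_colorP z i x x_n;
  have [?|?|?|?|?|?|?|?|?] := chain_colorP z j y y_n.
all: rewrite /cycle_dist; case: z_val => [z_val|[z_val j_lt2]];
  rewrite ?z_val => *; try discriminate.
all: lia.
Qed.

Lemma chain_color_sep z i x j y :
    0 < s -> z = 5 \/ [/\ z = 2, i < 2 & j < 2] -> x < n -> y < n ->
    i <> j \/ x <> y -> chain_color z i x = chain_color z j y ->
  chain_color z i x < chain_dist i x j y.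
Proof.
wlog le_ij : i x j y / i <= j => [IH s_gt0 z_val x_n y_n neq eq_c|].
  case: (leqP i j) => [|/ltnW] le_ij; first exact: IH.
  rewrite chain_distC eq_c; apply: IH => //; last by case: neq; auto.
  by case: z_val => [|[]]; [left | right].
move=> s_gt0 z_val x_n y_n neq eq_c; rewrite /chain_dist; case: eqP => [eq_ij|neq_ij].
  apply: chain_color_sep_in => //; last by rewrite eq_c eq_ij.
    by case: z_val => [|[]]; auto.
  by case: neq.
have lt_ij : i < j by lia.
by rewrite lt_ij; apply: chain_color_sep_out => //; case: z_val => [|[]]; auto.
Qed.

End CycleChain.

Section Position.

Variable s : nat.

Definition position (q : 2.-tuple 'I_(4 * s + 3)) (x : 'I_(4 * s + 3)) : nat :=
  let a := tnth q ord0 in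
  if ordS a == tnth q ord_max then (if a <= x then x - a else x + (4 * s + 3) - a)
  else (if x <= a then a - x else a + (4 * s + 3) - x).

Lemma position_lt q x : position q x < 4 * s + 3.
Proof.
rewrite /position; set a := tnth q ord0.
have := (ltn_ord a, ltn_ord x) => -[a_n x_n].
by case: ifP => _; case: ifP => ?; lia.
Qed.

Lemma position_inj q : injective (position q).
Proof.
move=> x y; rewrite /position; set a := tnth q ord0 => eq_xy; apply: ord_inj.
have := (ltn_ord a, ltn_ord x, ltn_ord y) => -[[a_n x_n] y_n].
by move: eq_xy; case: ifP => _; case: ifP => ?; case: ifP => ?; lia.
Qed.

Lemma position_ordS q x : cycle_adj s (position q x) (position q (ordS x)).
Proof.
rewrite /position val_ordS; set a := tnth q ord0.
have := (ltn_ord a, ltn_ord x) => -[a_n x_n].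
case: ifP => _; case: eqP => ?; rewrite ?leq0n; repeat (case: ifP => ?).
all: first [ by apply: CycleAdjNext; lia | by apply: CycleAdjPrev; lia
           | by apply: CycleAdjFirst; lia | by apply: CycleAdjLast; lia ].
Qed.

Lemma position_adj q x y :
  cycle_graph x y -> cycle_adj s (position q x) (position q y).
Proof.
case/orP=> /eqP <-; first exact: position_ordS.
case: (position_ordS q y) => *.
- exact: CycleAdjPrev.
- exact: CycleAdjNext.
- exact: CycleAdjLast.
- exact: CycleAdjFirst.
Qed.

Lemma position_first (q : 2.-tuple _) x : onth q 0 = Some x -> position q x = 0.
Proof.
case: q => -[|a [|b []]] //= q2 [<-].
by rewrite /position /tnth /= !leqnn subnn; case: ifP.
Qed.

Lemma position_second (q : 2.-tuple _) x :
    path_in (@cycle_graph _) q -> onth q 1 = Some x -> position q x = 1.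
Proof.
case: q => -[|a [|b []]] //= q2 q_path [<-]; move: q_path.
rewrite /position /tnth /= /path_in /= => /andP[_]; rewrite andbT => /orP adj_ab.
have := (ltn_ord a, ltn_ord b) => -[a_n b_n].
case: eqP => [<-|/eqP nab].
  by rewrite val_ordS; case: eqP => ?; case: ifP => ?; lia.
case: adj_ab => [/idPn //|/eqP <-]; rewrite val_ordS.
by case: eqP => ?; case: ifP => ?; lia.
Qed.

End Position.

Section CycleProduct.

Variables (s t : nat) (p : 'I_((2 * t) %/ 2) -> 2.-tuple 'I_(4 * s + 3)).
Hypotheses (s_gt0 : 0 < s) (p_path : forall i, path_in (@cycle_graph _) (p i)).

Let e := path_aligned_product (@cycle_graph (4 * s + 3)) p.
Let vertex : Type := 'I_((2 * t) %/ 2) * 'I_(4 * s + 3).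
Let pos (u : vertex) := position s (p u.1) u.2.

Lemma product_chain_adj u v : e u v -> chain_adj s u.1 (pos u) v.1 (pos v).
Proof.
have path_adj j x y : path_vertex p j x -> path_vertex p j.+1 y ->
    chain_adj s x.1 (pos x) y.1 (pos y).
  rewrite /path_vertex => /andP[/eqP xj /eqP pj] /andP[/eqP yj /eqP pj1].
  have [j_odd|j_even] := boolP (odd j).
    have [j1 j2] : j %% 2 = 1 /\ j.+1 %% 2 = 0 by lia.
    rewrite j1 in pj; rewrite j2 in pj1.
    apply: ChainAdjNext; [lia| exact: position_second | exact: position_first].
  have [j1 j2] : j %% 2 = 0 /\ j.+1 %% 2 = 1 by lia.
  rewrite j1 in pj; rewrite j2 in pj1.
  apply: ChainAdjIn; first lia.
  by apply: CycleAdjNext; rewrite /pos (position_first _ _ _ pj) position_second.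
case/orP=> [/andP[/eqP eq1 adj]|/existsP[j /orP[]/andP[]]].
- by apply: ChainAdjIn; rewrite ?eq1 // /pos eq1; apply: position_adj.
- exact: path_adj.
- by move=> vj uj; apply/chain_adj_sym/(path_adj j).
Qed.

Lemma product_packing_colorable z k :
    z = 5 \/ z = 2 /\ t <= 2 -> 3 < k -> z <= k -> packing_colorable e k.
Proof.
case: k => // k z_val k_gt3 z_le.
pose f (u : vertex) := chain_color s z u.1 (pos u).
have f_bounds u : 0 < f u <= k.+1.
  by rewrite /f; case: (chain_colorP s z u.1 (pos u) (position_lt _ _ _)); lia.
apply/existsP; exists [ffun u => inord (f u).-1].
apply/forallP=> u; apply/forallP=> v; apply/implyP=> /andP[neq_uv].
have cE w : color [ffun u0 => inord (f u0).-1 : 'I_k.+1] w = f w.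
  by rewrite /color ffunE inordK; have := f_bounds w; lia.
rewrite !cE => /eqP eq_f.
pose D (w : vertex) := chain_dist s w.1 (pos w) v.1 (pos v).
have lt_fD : f u < D u.
  apply: chain_color_sep eq_f; rewrite ?position_lt //.
    case: z_val => [|[-> t_le2]]; [by left | right].
    by split=> //; apply: leq_trans (ltn_ord _) _; lia.
  have [eq1|/eqP] := eqVneq u.1 v.1; last by left=> /ord_inj.
  right; rewrite /pos eq1 => /position_inj eq2; case/eqP: neq_uv.
  by apply/eqP; rewrite -pair_eqE /pair_eq eq1 eq2 !eqxx.
suff: gdist_ge e u v (D u).
  by rewrite /gdist_ge; case: gdist => // d; apply: leq_trans.
apply: gdist_ge_lipschitz => [|x y /product_chain_adj].
  by rewrite /D /chain_dist /cycle_dist eqxx maxnn minnn subnn min0n.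
by apply: chain_dist_lipschitz; rewrite ?position_lt.
Qed.

Lemma product_packing_chromatic_number_ge4 :
  0 < t -> 3 < packing_chromatic_number e.
Proof.
move=> t_gt0; have i0_lt : 0 < (2 * t) %/ 2 by lia.
rewrite /packing_chromatic_number; case: ex_minnP => k k_col _.
apply: (@odd_cycle_packing_ge4 (4 * s + 3) _ e (pair (Ordinal i0_lt))) k_col.
- by move=> x y [].
- by move=> x y adj; apply/orP; left; apply/andP.
- lia.
- lia.
Qed.

End CycleProduct.

Theorem theorem11 (s t : nat) (hs : 1 <= s) (ht : 1 <= t)
    (p : 'I_((2 * t) %/ 2) -> 2.-tuple 'I_(4 * s + 3))
    (hp : forall i, path_in (@cycle_graph (4 * s + 3)) (p i)) :
  [/\ 1 <= t <= 2 ->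
        packing_chromatic_number
          (path_aligned_product (@cycle_graph (4 * s + 3)) p) <= 4,
      3 <= t ->
        packing_chromatic_number
          (path_aligned_product (@cycle_graph (4 * s + 3)) p) <= 5
    & t = 1 \/ t = 2 ->
        packing_chromatic_number
          (path_aligned_product (@cycle_graph (4 * s + 3)) p) = 4].
Proof.
have le4 : t <= 2 -> packing_chromatic_number
    (path_aligned_product (@cycle_graph (4 * s + 3)) p) <= 4.
  move=> t_le2; apply/packing_chromatic_number_le.
  by apply: (product_packing_colorable _ _ p hs hp 2) => //; right.
split=> [/andP[_]|_|t12]; first exact: le4.
  apply/packing_chromatic_number_le.
  by apply: (product_packing_colorable _ _ p hs hp 5) => //; left.
apply/eqP; rewrite eqn_leq product_packing_chromatic_number_ge4 // andbT.
by apply: le4; lia.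
Qed.
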